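(* Let $(k_n)_{n\geq 1}$ be an increasing sequence of positive integers tending to $+\infty$. Then the proportion, among the $T_n$ equivalence classes of $\mathsf{and/or}$ trees of size $n$ in which at most $k_n$ distinct variables occur, of those classes whose trees compute a satisfiable Boolean function (i.e. a function not identically equal to $0$) tends to $1$ as $n\to+\infty$.
   Context: Variables are $x_1,x_2,\dots$ (Boolean functions are maps $\{0,1\}^{\mathbb N}\to\{0,1\}$); a literal is a variable $x_i$ or its negation $\bar x_i=1-x_i$. An $\mathsf{and/or}$ tree is a finite binary plane tree whose internal nodes are labelled by $\land$ or $\lor$ and whose leaves are labelled by literals; it computes a Boolean function in the obvious way. Its size is its number of leaves. Two $\mathsf{and/or}$ trees $A,B$ are equivalent if (1) they have the same underlying plane tree with the same connective labels on internal nodes, (2) two leaves are labelled by the same variable (negated or not) in $A$ iff they are in $B$, and (3) two leaves are labelled by the same literal in $A$ iff they are in $B$. Equivalent trees compute functions that are either both satisfiable or both not. $T_n$ denotes the number of equivalence classes of $\mathsf{and/or}$ trees of size $n$ in which at most $k_n$ distinct variables occur as leaf labels (negated or not); the ''random Catalan expression'' is a uniformly random such class. *)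

(* Defs.v *)
From mathcomp Require Import all_boot all_order all_algebra finmap.
From mathcomp Require Import all_classical all_reals all_analysis.

Set Implicit Arguments.
Unset Strict Implicit.
Unset Printing Implicit Defensive.

Local Open Scope classical_set_scope.

Inductive connective := And | Or.

Record literal := Literal { lit_var : nat; lit_neg : bool }.

Inductive tree (L : Type) :=
| Leaf of L
| Node of connective & tree L & tree L.

Fixpoint leaves (L : Type) (t : tree L) : seq L :=
  match t with
  | Leaf l => [:: l]
  | Node _ a b => leaves a ++ leaves b
  end.

Definition tree_size (L : Type) (t : tree L) : nat := size (leaves t).

Fixpoint skeleton (L : Type) (t : tree L) : tree unit :=
  match t with
  | Leaf _ => Leaf tt
  | Node c a b => Node c (skeleton a) (skeleton b)
  end.

Definition andor_tree := tree literal.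

Definition boolean_function := (nat -> bool) -> bool.

Definition lit_eval (l : literal) : boolean_function :=
  fun v => if lit_neg l then ~~ v (lit_var l) else v (lit_var l).

Fixpoint computes (t : andor_tree) : boolean_function :=
  fun v =>
    match t with
    | Leaf l => lit_eval l v
    | Node And a b => computes a v && computes b v
    | Node Or a b => computes a v || computes b v
    end.

Definition satisfiable (f : boolean_function) : Prop := exists v, f v = true.

Definition nb_vars (t : andor_tree) : nat :=
  size (undup [seq lit_var l | l <- leaves t]).

(* The default value is never reached at positions [i < tree_size t]. *)
Definition leaf_at (t : andor_tree) (i : nat) : literal :=
  nth (Literal 0 false) (leaves t) i.

(* Leaves are identified by their rank in the left-to-right order; once the
   skeletons agree, equal ranks mean the same leaf of the plane tree. *)
Definition equiv_tree (A B : andor_tree) : Prop :=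
  [/\ skeleton A = skeleton B,
      forall i j, i < tree_size A -> j < tree_size A ->
        (lit_var (leaf_at A i) = lit_var (leaf_at A j) <->
         lit_var (leaf_at B i) = lit_var (leaf_at B j))
    & forall i j, i < tree_size A -> j < tree_size A ->
        (leaf_at A i = leaf_at A j <-> leaf_at B i = leaf_at B j)].

Definition equiv_class (t : andor_tree) : set andor_tree :=
  [set u | equiv_tree t u].

Definition classes (n k : nat) : set (set andor_tree) :=
  equiv_class @` [set t | tree_size t = n /\ nb_vars t <= k].

Definition sat_classes (n k : nat) : set (set andor_tree) :=
  [set C | classes n k C /\ forall t, C t -> satisfiable (computes t)].

(* [fset_set] is the empty set on infinite sets; [finite_classes] below shows
   that this case does not arise. *)
Definition card_classes (n k : nat) : nat := #|` fset_set (classes n k)|.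

Definition card_sat_classes (n k : nat) : nat :=
  #|` fset_set (sat_classes n k)|.

Lemma tree_size_gt0 (L : Type) (t : tree L) : 0 < tree_size t.
Proof.
by elim: t => [//|c a IHa b IHb]; rewrite /tree_size /= size_cat addn_gt0 IHa.
Qed.

Lemma tree_size_skeleton (L : Type) (t : tree L) :
  tree_size (skeleton t) = tree_size t.
Proof.
elim: t => [//|c a IHa b IHb].
by move: IHa IHb; rewrite /tree_size /= !size_cat => -> ->.
Qed.

Lemma finite_skeletons (n : nat) : finite_set [set s : tree unit | tree_size s <= n].
Proof.
elim: n => [|n IHn].
  apply: (sub_finite_set _ (@finite_set0 _)) => s /=.
  by rewrite leqNgt tree_size_gt0.
set S := [set s | tree_size s <= n] in IHn.
pose N c (p : tree unit * tree unit) := Node c p.1 p.2.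
have fN c : finite_set (N c @` (S `*` S)).
  by apply: finite_image; apply: finite_setX.
apply: (sub_finite_set _ (B := [set Leaf tt] `|` (N And @` (S `*` S)
   `|` N Or @` (S `*` S)))); last first.
  by rewrite !finite_setU; split=> //; exact: finite_set1.
case=> [[]|c a b] /=; first by left.
rewrite /tree_size /= size_cat => h.
have ha : S a.
  by rewrite /S /= -ltnS (leq_trans _ h)// -addn1 leq_add2l (tree_size_gt0 b).
have hb : S b.
  by rewrite /S /= -ltnS (leq_trans _ h)// -add1n leq_add2r (tree_size_gt0 a).
by right; case: c; [left|right]; exists (a, b).
Qed.

Lemma finite_classes (n k : nat) : finite_set (classes n k).
Proof.
pose table := {ffun 'I_n * 'I_n -> bool * bool}.
pose F (p : tree unit * table) : set andor_tree := [set u |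
  [/\ p.1 = skeleton u,
      forall i j : 'I_n, (p.2 (i, j)).1 <->
         lit_var (leaf_at u i) = lit_var (leaf_at u j)
    & forall i j : 'I_n, (p.2 (i, j)).2 <-> leaf_at u i = leaf_at u j]].
apply: (sub_finite_set _ (B := F @` ([set s | tree_size s <= n] `*` setT))).
  move=> C [t [tn _] <-].
  exists (skeleton t, [ffun ij : 'I_n * 'I_n =>
     (`[< lit_var (leaf_at t ij.1) = lit_var (leaf_at t ij.2) >],
      `[< leaf_at t ij.1 = leaf_at t ij.2 >])]).
    by split=> //=; rewrite tree_size_skeleton tn.
  apply/seteqP; split=> u /= [su hv hl]; split=> // i j.
  - rewrite tn => hi hj.
    have := hv (Ordinal hi) (Ordinal hj); rewrite ffunE /= => <-.
    by split=> /asboolP.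
  - rewrite tn => hi hj.
    have := hl (Ordinal hi) (Ordinal hj); rewrite ffunE /= => <-.
    by split=> /asboolP.
  - by rewrite ffunE /= -hv ?tn //; split=> /asboolP.
  - by rewrite ffunE /= -hl ?tn //; split=> /asboolP.
by apply: finite_image; apply: finite_setX; [exact: finite_skeletons|exact: finite_finset].
Qed.

Lemma finite_sat_classes (n k : nat) : finite_set (sat_classes n k).
Proof. by apply: sub_finite_set (finite_classes n k) => C []. Qed.

(* Main.v *)
From HB Require Import structures.
Require Import Defs.
From mathcomp Require Import all_boot all_order all_algebra.
From mathcomp Require Import finmap zify.
From mathcomp Require Import all_classical all_reals all_analysis.
Import Order.TTheory GRing.Theory Num.Theory.
Import numFieldNormedType.Exports.

Set Implicit Arguments.
Unset Strict Implicit.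
Unset Printing Implicit Defensive.

(* In an and/or tree, follow both children of every conjunction and only the
   left child of every disjunction. Making the literals on the leaves so
   selected true makes the tree true, hence the tree is satisfiable as soon as
   these leaves carry pairwise distinct variables.
   An equivalence class amounts to an independent choice of a skeleton and of a
   pattern recording which leaves share their variable or literal.
   For a uniform skeleton of size [n], the mean number of selected leaves is
   at most 6 for all [n]: with [A] and [M] the generating functions of
   skeletons and of selected leaves, [A = z + 2 A^2] and [M = z + 3 M A], whence
   [(1 - 9 z) M = z (1 - 6 A)].
   For a uniform pattern with at most [k] variables, two given leaves share
   their variable with small probability: patterns with fewer than [Q] variables
   are exponentially rare, and in the others one leaf of a linked pair can be
   moved to [Q] different blocks.
   A union bound over pairs of selected leaves and Markov's inequality for the
   number of selected leaves conclude. *)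

(** * Numerical recurrences *)

Lemma geometric_beats_linear (c P : nat) :
  exists n0, forall n, n0 <= n -> c * P ^ n <= P.+1 ^ n.
Proof.
(* Bernoulli's inequality [(1 + 1/P)^n >= 1 + n/P], cleared of denominators. *)
have bern n : P ^ n * P + n * P ^ n <= P.+1 ^ n * P.
  elim: n => [|n IHn]; first by rewrite !expn0; lia.
  rewrite !expnS; move: IHn; set x := P ^ n; set y := P.+1 ^ n; nia.
exists (c * P).+1 => n hn; case: P bern hn => [|P] bern hn.
  by rewrite exp0n ?muln0//; lia.
rewrite -(leq_pmul2r (ltn0Sn P)); apply: leq_trans (bern n).
by apply: leq_trans (leq_addl _ _); rewrite mulnAC leq_mul2r; apply/orP; right; lia.
Qed.

Section Convolution.
Variables (A M : nat -> nat).
Hypothesis A0 : A 0 = 1.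
Hypothesis AS : forall n, A n.+1 = 2 * \sum_(i < n.+1) A i * A (n - i).

(** The symmetry [i <-> n - i] gives [i.+1] the mean weight [n.+2 / 2]. *)
Lemma conv_weighted n :
  2 * (\sum_(i < n.+1) i.+1 * (A i * A (n - i))) =
  n.+2 * \sum_(i < n.+1) A i * A (n - i).
Proof.
rewrite mul2n -addnn {2}(reindex_inj rev_ord_inj) /= -big_split big_distrr /=.
apply: eq_bigr => i _; have hi := ltn_ord i.
rewrite subSS subKn -1?ltnS// (mulnC (A (n - i))) -mulnDl; congr (_ * _); lia.
Qed.

(** [A n] is [2 ^ n] times the Catalan number, and this is its two-term recurrence. Under the
    weighted convolution, the induction hypothesis reads [(i+2) A(i+1) = 8 (i+1) A(i) - 4 A(i)]. *)
Lemma catalan_ratio n : n.+2 * A n.+1 = 4 * (n.*2.+1 * A n).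
Proof.
elim/ltn_ind: n => -[_|n IH]; first by rewrite AS big_ord1 A0.
rewrite AS mulnCA -conv_weighted big_ord_recl /= subn0 A0.
rewrite (eq_bigr (fun i : 'I_n.+1 =>
  8 * (i.+1 * (A i * A (n - i))) - 4 * (A i * A (n - i)))); last first.
  move=> i _; rewrite /bump /= add1n subSS.
  have := IH i (ltn_ord i); set x := A i; set y := A i.+1; set z := A _ => h.
  rewrite mulnA h; nia.
rewrite sumnB; last by move=> i _; nia.
rewrite -!big_distrr /=.
have := conv_weighted n; have := AS n.
set S := \sum_(i < n.+1) A i * A (n - i).
set W := \sum_(i < n.+1) i.+1 * _.
rewrite -/S -/W => h1 h2; nia.
Qed.

Lemma catalan_growth n : A n.+1 <= 8 * A n.
Proof. have := catalan_ratio n; nia. Qed.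

Hypothesis M0 : M 0 = 1.
Hypothesis MS : forall n, M n.+1 = 3 * \sum_(i < n.+1) M i * A (n - i).

(** Coefficients of [(1 - 9 z) M = z (1 - 6 A)], index [n] standing for size [n.+1]. The induction
    hypothesis is substituted under the sum of [MS], once the term [i = 0] is split off. *)
Lemma linear_recurrence n : M n.+1 + 6 * A n = 9 * M n.
Proof.
elim/ltn_ind: n => -[_|n IH]; first by rewrite MS big_ord1 M0 A0.
rewrite (MS n.+1) big_ord_recl /= subn0 M0.
rewrite (eq_bigr (fun i : 'I_n.+1 =>
  9 * (M i * A (n - i)) - 6 * (A i * A (n - i)))); last first.
  move=> i _; rewrite /bump /= add1n subSS.
  move: (IH i (ltn_ord i)); move: (A (i : nat)) (M i.+1) (A (n - i)) (M i) => x y z m h.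
  by rewrite (_ : y = 9 * m - 6 * x) ?mulnBl -?mulnA //; lia.
rewrite sumnB; last first.
  by move=> i _; rewrite !mulnA leq_mul2r; have := IH i (ltn_ord i); lia.
rewrite -!big_distrr /=.
have le : 6 * \sum_(i < n.+1) A i * A (n - i) <= 9 * \sum_(i < n.+1) M i * A (n - i).
  rewrite !big_distrr; apply: leq_sum => i _ /=.
  by rewrite !mulnA leq_mul2r; have := IH i (ltn_ord i); lia.
rewrite (AS n) (MS n); move: le; move: (\sum_(i < _) _) (\sum_(i < _) _) => S W; lia.
Qed.

Hypothesis M_le : forall n, M n <= n.+1 * A n.

(* [M - 6 A] is multiplied by at least 9 at each step, so it would outgrow
   [n.+1 * A n <= n.+1 * 8 ^ n] if it were ever positive. *)
Lemma total_bound n : M n <= 6 * A n.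
Proof.
rewrite leqNgt; apply/negP => hn.
have grow j : 6 * A (n + j) + 9 ^ j <= M (n + j).
  elim: j => [|j IH]; first by rewrite addn0 expn0 addn1.
  have := linear_recurrence (n + j); have := catalan_growth (n + j).
  rewrite addnS expnS; move: IH; lia.
have A8 m : A m <= 8 ^ m.
  elim: m => [|m IH]; first by rewrite A0.
  by apply: leq_trans (catalan_growth m) _; rewrite expnS leq_mul2l.
have lin i : i * 8 ^ i <= 8 * 9 ^ i.
  elim: i => [//|i]; rewrite !expnS.
  have : 8 ^ i <= 9 ^ i by case: i => // i; rewrite leq_exp2r.
  set x := 8 ^ i; set y := 9 ^ i; nia.
(* With exponent [i + i], squaring [lin] gains a factor of order [i * i] against the linear factor
   of [M_le]; this [i] is large enough to absorb [64 * 8 ^ n] as well. *)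
pose i := 64 * 8 ^ n * n.+3.
have := grow (i + i); have := M_le (n + (i + i)); have := A8 (n + (i + i)).
rewrite !expnD; have := lin i; have : 0 < 8 ^ n by rewrite expn_gt0.
have : 0 < 8 ^ i by rewrite expn_gt0.
move: (A _) (M _) => a m.
have ei : i = 64 * 8 ^ n * n.+3 by [].
move: ei; move: (8 ^ n) (8 ^ i) (9 ^ i) => e x y ei x0 e0 hl ha hm hg.
have h1 : y * y <= (n + (i + i)).+1 * (e * (x * x)).
  apply: leq_trans (leq_mul (leqnn _) ha); lia.
have h2 : (i * x) * (i * x) <= 64 * (y * y).
  by apply: leq_trans (leq_mul hl hl) _; lia.
have h3 : i * i * (x * x) <= 64 * (n + (i + i)).+1 * e * (x * x).
  apply: leq_trans (_ : _ <= 64 * (y * y)) _; first by lia.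
  by apply: leq_trans (leq_mul (leqnn 64) h1) _; lia.
rewrite leq_pmul2r ?muln_gt0 ?x0// in h3.
have h4 : i * (e * 64 * n.+3) <= (e * 64) * (n + (i + i)).+1 by rewrite {2}ei in h3; lia.
have h5 : i * n.+3 <= (n + (i + i)).+1.
  by rewrite -(leq_pmul2l (_ : 0 < e * 64)) ?muln_gt0 ?e0//; lia.
have : 1 < i by rewrite ei; nia.
nia.
Qed.
End Convolution.

HB.instance Definition _ := gen_eqMixin (tree unit).
HB.instance Definition _ := gen_choiceMixin (tree unit).

(** * Selected leaves *)

(* Leaves reached by following both children of a conjunction and only the left
   child of a disjunction, as ranks in the left-to-right order. *)
Fixpoint selected (L : Type) (t : tree L) : seq nat :=
  match t with
  | Leaf _ => [:: 0]
  | Node And a b => selected a ++ [seq tree_size a + i | i <- selected b]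
  | Node Or a _ => selected a
  end.

Lemma tree_size_Node (L : Type) c (a b : tree L) :
  tree_size (Node c a b) = tree_size a + tree_size b.
Proof. by rewrite /tree_size /= size_cat. Qed.

Lemma selected_skeleton (L : Type) (t : tree L) :
  selected (skeleton t) = selected t.
Proof.
by elim: t => //= -[] a IHa b IHb; rewrite IHa ?IHb ?tree_size_skeleton.
Qed.

Lemma selected_lt (L : Type) (t : tree L) i : i \in selected t -> i < tree_size t.
Proof.
elim: t i => [l|[] a IHa b IHb] i /=; first by rewrite inE => /eqP ->.
- rewrite tree_size_Node mem_cat => /orP[/IHa h|/mapP[j /IHb h ->]].
    by rewrite ltn_addr.
  by rewrite ltn_add2l.
- by rewrite tree_size_Node => /IHa h; rewrite ltn_addr.
Qed.

Lemma selected_true (t : andor_tree) v :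
  (forall i, i \in selected t -> lit_eval (leaf_at t i) v) -> computes t v.
Proof.
elim: t => [l|[] a IHa b IHb] /= h; first by apply: (h 0); rewrite inE.
- rewrite IHa ?IHb // => i hi.
  + have := h (tree_size a + i); rewrite /leaf_at /= nth_cat /tree_size.
    rewrite ltnNge leq_addr /= addKn; apply.
    by rewrite mem_cat; apply/orP; right; apply: map_f.
  + have := h i; rewrite /leaf_at /= nth_cat (selected_lt hi); apply.
    by rewrite mem_cat hi.
- rewrite IHa // => i hi.
  by have := h i; rewrite /leaf_at /= nth_cat (selected_lt hi); apply.
Qed.

Lemma selected_satisfiable (t : andor_tree) :
  (forall i j, i \in selected t -> j \in selected t -> i != j ->
    lit_var (leaf_at t i) != lit_var (leaf_at t j)) -> satisfiable (computes t).
Proof.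
move=> dist.
(* A variable is true exactly when some selected leaf carries it unnegated. A negated selected leaf
   is then true, since no other selected leaf has its variable. *)
exists (fun x => has (fun i => (lit_var (leaf_at t i) == x) &&
                               ~~ lit_neg (leaf_at t i)) (selected t)).
apply: selected_true => i hi; rewrite /lit_eval.
case E: (lit_neg _); last by apply/hasP; exists i => //; rewrite eqxx E.
apply/hasPn => j hj; have [<-|ij] := eqVneq i j; first by rewrite E andbF.
by rewrite eq_sym (negPf (dist _ _ hi hj ij)).
Qed.

(** * Enumeration of skeletons and mean number of selected leaves *)

Definition skeletons (n : nat) : seq (tree unit) :=
  fset_set [set s : tree unit | tree_size s = n]%classic.

Lemma mem_skeletons n s : (s \in skeletons n) = (tree_size s == n).
Proof.
have fin : finite_set [set s : tree unit | tree_size s = n]%classic.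
  by apply: sub_finite_set (finite_skeletons n) => u /= ->.
rewrite /skeletons in_fset_set//.
by apply/idP/eqP; rewrite inE.
Qed.

Lemma skeletons_uniq n : uniq (skeletons n).
Proof. exact: fset_uniq. Qed.

Lemma skeletons1 : skeletons 1 = [:: Leaf tt].
Proof.
apply/perm_small_eq => //; apply: uniq_perm => //; first exact: skeletons_uniq.
move=> s; rewrite mem_skeletons inE; case: s => [[]|c a b]; first by rewrite eqxx.
rewrite tree_size_Node; have := tree_size_gt0 a; have := tree_size_gt0 b.
by move=> ha hb; transitivity false; [lia|apply/esym/eqP].
Qed.

(** Both subtrees are nonempty, so the left size is written [i.+1] and the total is [n.+2]. *)
Definition skeleton_pairs (n : nat) : seq (tree unit * tree unit) :=
  [seq p | i <- iota 0 n.+1,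
           p <- [seq (a, b) | a <- skeletons i.+1, b <- skeletons (n - i).+1]].

Lemma mem_skeleton_pairs n p :
  (p \in skeleton_pairs n) = (tree_size p.1 + tree_size p.2 == n.+2).
Proof.
apply/allpairsPdep/eqP => [[i [q [hi /allpairsP[[a b] /= [ha hb ->]] ->]]]|h].
  move: hi ha hb; rewrite mem_iota !mem_skeletons => hi /eqP -> /eqP -> /=.
  by rewrite addSn addnS subnKC//; lia.
have := tree_size_gt0 p.1; have := tree_size_gt0 p.2 => h2 h1.
exists (tree_size p.1).-1, p; split=> //; first by rewrite mem_iota; lia.
apply/allpairsP; exists p; split; last by case: p {h h1 h2}.
- by rewrite mem_skeletons prednK.
- by rewrite mem_skeletons; apply/eqP; lia.
Qed.

Lemma skeleton_pairs_uniq n : uniq (skeleton_pairs n).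
Proof.
apply: (@allpairs_uniq_dep _ (fun=> (tree unit * tree unit)%type : eqType)).
- exact: iota_uniq.
- move=> i _; apply: allpairs_uniq; [exact: skeletons_uniq..|].
  by move=> [a b] [c d] _ _.
(* The left size determines [i], so different indices yield disjoint lists. *)
- have tag_eq i p : p \in [seq (a, b) | a <- skeletons i.+1,
      b <- skeletons (n - i).+1] -> i = (tree_size p.1).-1.
    by move=> /allpairsP[[a b] /= [+ _ ->]]; rewrite mem_skeletons => /eqP ->.
  move=> u v /allpairsPdep[i [p [_ /tag_eq hi ->]]].
  by move=> /allpairsPdep[j [q [_ /tag_eq hj ->]]] /= e; rewrite hi hj e.
Qed.

Lemma skeletons_rec n : perm_eq (skeletons n.+2)
  ([seq Node And p.1 p.2 | p <- skeleton_pairs n] ++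
   [seq Node Or p.1 p.2 | p <- skeleton_pairs n]).
Proof.
have inj c : injective (fun p : tree unit * tree unit => Node c p.1 p.2).
  by move=> [a b] [a' b'] [-> ->].
apply: uniq_perm; first exact: skeletons_uniq.
  rewrite cat_uniq !map_inj_uniq ?skeleton_pairs_uniq ?andbT //=.
  by apply/hasPn => s /mapP[p _ ->]; apply/negP => /mapP[q _].
move=> s; rewrite mem_skeletons mem_cat; apply/eqP/orP.
  case: s => [//|c a b]; rewrite tree_size_Node => h.
  by case: c; [left|right]; apply/mapP; exists (a, b); rewrite ?mem_skeleton_pairs ?h.
by case=> /mapP[p]; rewrite mem_skeleton_pairs => /eqP <- ->; rewrite tree_size_Node.
Qed.

Lemma sum_skeletons (F : tree unit -> nat) n :
  \sum_(s <- skeletons n.+2) F s = \sum_(i < n.+1)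
    \sum_(a <- skeletons i.+1) \sum_(b <- skeletons (n - i).+1)
      (F (Node And a b) + F (Node Or a b)).
Proof.
rewrite (perm_big _ (skeletons_rec n)) big_cat !big_map /= -big_split /=.
rewrite /skeleton_pairs big_flatten big_map -(big_mkord xpredT (fun i =>
  \sum_(a <- skeletons i.+1) \sum_(b <- skeletons (n - i).+1)
      (F (Node And a b) + F (Node Or a b)))) /index_iota subn0.
apply: eq_bigr => i _.
by rewrite map_id big_flatten big_map; apply: eq_bigr => a _; rewrite big_map.
Qed.

Lemma sum_seq_const (T : Type) (r : seq T) c : \sum_(i <- r) c = size r * c.
Proof. by rewrite big_const_seq count_predT iter_addn_0 mulnC. Qed.

(** Sizes are shifted by one, so that index 0 is the single leaf, as in the convolution
    recurrences. *)
Definition nb_skeletons n := size (skeletons n.+1).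
Definition nb_selected n := \sum_(s <- skeletons n.+1) size (selected s).

Lemma nb_skeletonsS n : nb_skeletons n.+1 =
  2 * \sum_(i < n.+1) nb_skeletons i * nb_skeletons (n - i).
Proof.
rewrite /nb_skeletons -sum1_size sum_skeletons big_distrr.
by apply: eq_bigr => i _ /=; rewrite !sum_seq_const addn1 mulnA mulnC.
Qed.

Lemma selected_size (s : tree unit) : size (selected s) <= tree_size s.
Proof.
elim: s => [l|[] a IHa b IHb] //=; rewrite tree_size_Node.
  by rewrite size_cat size_map leq_add.
by rewrite (leq_trans IHa) ?leq_addr.
Qed.

(** The left child contributes under both connectives and the right child only under [And];
    reflecting the sum merges [2 + 1] into 3. *)
Lemma nb_selectedS n : nb_selected n.+1 =
  3 * \sum_(i < n.+1) nb_selected i * nb_skeletons (n - i).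
Proof.
transitivity (\sum_(i < n.+1) (2 * (nb_selected i * nb_skeletons (n - i)) +
                                nb_skeletons i * nb_selected (n - i))).
  rewrite /nb_selected sum_skeletons; apply: eq_bigr => i _.
  transitivity (\sum_(a <- skeletons i.+1)
      (2 * size (selected a) * nb_skeletons (n - i) + nb_selected (n - i))).
    apply: eq_bigr => a _; rewrite mulnC -sum_seq_const -big_split /=.
    by apply: eq_bigr => b _; rewrite size_cat size_map; lia.
  by rewrite big_split /= sum_seq_const -big_distrl -big_distrr /= mulnA.
rewrite big_split /= -big_distrr /= [X in _ + X](reindex_inj rev_ord_inj) /=.
rewrite -[3]/(2 + 1) mulnDl mul1n; congr (_ + _); apply: eq_bigr => i _.
by have := ltn_ord i; rewrite ltnS => hi; rewrite subSS subKn// mulnC.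
Qed.

Lemma mean_selected n : 0 < n ->
  \sum_(s <- skeletons n) size (selected s) <= 6 * size (skeletons n).
Proof.
case: n => // n _.
apply: (@total_bound nb_skeletons nb_selected _ nb_skeletonsS _ nb_selectedS).
- by rewrite /nb_skeletons skeletons1.
- by rewrite /nb_selected skeletons1 big_seq1.
- move=> m; rewrite /nb_selected /nb_skeletons mulnC
     -sum_seq_const big_seq [leqRHS]big_seq.
  apply: leq_sum => s; rewrite mem_skeletons => /eqP <-.
  exact: selected_size.
Qed.

(** * Patterns of leaf labels *)

Definition table n := {ffun 'I_n * 'I_n -> bool * bool}.

(** The two bits record same variable and same literal. [V] is left free because trees have
    variables in [nat] while [patterns] takes them in ['I_k]. *)
Definition pattern (V : eqType) n (f : 'I_n -> V * bool) : table n :=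
  [ffun p => ((f p.1).1 == (f p.2).1, f p.1 == f p.2)].

Definition patterns n k : {set table n} :=
  [set pattern f | f : {ffun 'I_n -> 'I_k * bool}].

Lemma pattern_in n k (f : 'I_n -> 'I_k * bool) : pattern f \in patterns n k.
Proof.
apply/imsetP; exists (finfun f) => //.
by apply/ffunP => p; rewrite !ffunE.
Qed.

(** Replacing each variable by its rank among those that occur preserves the pattern. *)
Lemma pattern_few (V : eqType) n k (f : 'I_n -> V * bool) :
  size (undup [seq (f i).1 | i <- enum 'I_n]) <= k -> pattern f \in patterns n k.
Proof.
set vs := undup _ => hk.
have vin i : (f i).1 \in vs by rewrite mem_undup; apply: map_f; rewrite mem_enum.
have idx i : index (f i).1 vs < k.
  by apply: leq_trans hk; rewrite index_mem.
pose g i := (Ordinal (idx i), (f i).2).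
suff -> : pattern f = pattern g by apply: pattern_in.
apply/ffunP => -[i j]; rewrite !ffunE /=.
have e : ((f i).1 == (f j).1) = (Ordinal (idx i) == Ordinal (idx j)).
  apply/eqP/eqP => [e|[] e]; first by apply: val_inj => /=; rewrite e.
  by rewrite -(nth_index (f i).1 (vin i)) e nth_index.
by congr (_, _) => //; rewrite -[f i == f j]/(_ && _) e.
Qed.

Lemma card_patterns_le n k : #|patterns n k| <= (2 * k) ^ n.
Proof.
apply: leq_trans (leq_imset_card _ _) _.
by rewrite card_ffun card_prod card_bool !card_ord mulnC.
Qed.

(** The first [Q] positions carry the [Q] variables unnegated. Comparison with them reads the labels
    of the other [r] positions off the pattern, so all these labellings have distinct patterns. *)
Lemma card_patterns_ge Q r k : Q <= k -> (2 * Q) ^ r <= #|patterns (Q + r) k|.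
Proof.
move=> Qk.
pose F (g : {ffun 'I_r -> 'I_Q * bool}) (i : 'I_(Q + r)) : 'I_k * bool :=
  match fintype.split i with
  | inl a => (widen_ord Qk a, false)
  | inr b => (widen_ord Qk (g b).1, (g b).2)
  end.
have Fl g a : F g (lshift r a) = (widen_ord Qk a, false).
  by rewrite /F (unsplitK (inl a : 'I_Q + 'I_r)).
have Fr g b : F g (rshift Q b) = (widen_ord Qk (g b).1, (g b).2).
  by rewrite /F (unsplitK (inr b : 'I_Q + 'I_r)).
have winj : injective (widen_ord Qk) by move=> a b [] /val_inj.
have inj : injective (fun g => pattern (F g)).
  move=> g h /ffunP e; apply/ffunP => b.
  have := e (lshift r (g b).1, rshift Q b).
  rewrite !ffunE /= !Fl !Fr /= eqxx => -[].
  move=> /esym/eqP/winj; case: (g b) (h b) => [v x] [w y] /= <-.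
  by rewrite !xpair_eqE eqxx /=; case: x y => -[].
rewrite -[2 * Q]mulnC -{1}(card_ord Q) -card_bool -card_prod -{1}(card_ord r).
rewrite -card_ffun -(card_imset _ inj) subset_leq_card //.
by apply/fintype.subsetP => _ /imsetP[g _ ->]; apply: pattern_in.
Qed.

(** * Rarity of a link between two given leaves *)

Definition separated n Q (l : table n) (g : 'I_Q -> 'I_n) :=
  [forall a, forall b, (l (g a, g b)).1 ==> (a == b)].

Lemma separatedP n Q (l : table n) (g : 'I_Q -> 'I_n) :
  reflect (forall a b, (l (g a, g b)).1 -> a = b) (separated l g).
Proof.
apply: (iffP forallP) => [h a b lab|h a].
  by have /forallP/(_ b)/implyP/(_ lab)/eqP := h a.
by apply/forallP => b; apply/implyP => /h ->.
Qed.

(** At least [Q] variables occur, expressed on the table without choosing a labelling. *)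
Definition has_blocks n Q (l : table n) :=
  [exists g : {ffun 'I_Q -> 'I_n}, separated l g].

(** If more than [P] variables occurred, one position for each of [P.+1] of them would be a
    separated family. *)
Lemma few_blocks n k P (l : table n) :
  l \in patterns n k -> ~~ has_blocks P.+1 l -> l \in patterns n P.
Proof.
case/imsetP => f _ -> nb; apply: pattern_few; rewrite leqNgt; apply: contra nb.
set vs := undup _ => hP.
have [v0] : exists v0 : 'I_k, v0 \in vs.
  by case: (vs) hP => // v s _; exists v; rewrite inE eqxx.
move=> _; have ex (a : 'I_P.+1) : exists i : 'I_n, (f i).1 = nth v0 vs a.
  have : nth v0 vs a \in vs.
    by apply: mem_nth; apply: leq_trans hP; exact: ltn_ord.
  rewrite mem_undup => /mapP[i _ e]; exists i; rewrite e //.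
have [g hg] := fin_all_exists ex.
apply/existsP; exists (finfun g); apply/separatedP => a b.
have lt (c : 'I_P.+1) : c < size vs by apply: leq_trans hP; exact: ltn_ord.
by rewrite !ffunE /= !hg nth_uniq ?undup_uniq ?lt // => /eqP/val_inj.
Qed.

Lemma card_few_blocks n k P :
  #|[set l in patterns n k | ~~ has_blocks P.+1 l]| <= (2 * P) ^ n.
Proof.
apply: leq_trans (card_patterns_le n P); apply/subset_leq_card/fintype.subsetP => l.
by rewrite inE => /andP[]; exact: few_blocks.
Qed.

(* Where the blocks of [l] can be found when position [j] is forgotten. *)
Definition blocks_off n Q (j i : 'I_n) (l : table n) : {ffun 'I_Q -> 'I_n} :=
  odflt [ffun=> i] [pick g : {ffun 'I_Q -> 'I_n} |
                     separated l g && [forall a, g a != j]].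

(** As [i] has the variable of [j], it can replace [j] in a separated family; the default of
    [blocks_off] is thus not reached. *)
Lemma blocks_offP n k Q (i j : 'I_n) (l : table n) :
  i != j -> l \in patterns n k -> (l (i, j)).1 -> has_blocks Q l ->
  separated l (blocks_off Q j i l) /\ forall a, blocks_off Q j i l a != j.
Proof.
move=> ij /imsetP[f _ ->] lij /existsP[g /separatedP sg].
rewrite /blocks_off; case: pickP => [h /andP[sh /forallP hj]|/= none]; first by [].
pose h := [ffun a => if g a == j then i else g a].
have/negP := negbT (none h); case; apply/andP; split; last first.
  by apply/forallP => a; rewrite ffunE; case: ifP => [_|/negbT].
have eh a : (f (h a)).1 = (f (g a)).1.
  rewrite ffunE; case: eqP => // ->; by move: lij; rewrite ffunE /= => /eqP.
by apply/separatedP => a b; rewrite ffunE /= !eh => e; apply: sg; rewrite ffunE.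
Qed.

(** Since [j] has the variable of [i], one bit, equal or opposite literal, determines the row and
    column of [j] from those of [i]. *)
Lemma table_off n k (i j : 'I_n) (l m : table n) : i != j ->
  l \in patterns n k -> m \in patterns n k ->
  (l (i, j)).1 -> (m (i, j)).1 -> (l (i, j)).2 = (m (i, j)).2 ->
  (forall x y, x != j -> y != j -> l (x, y) = m (x, y)) -> l = m.
Proof.
move=> ij /imsetP[f _ ->] /imsetP[g _ ->]; rewrite !ffunE /=.
move=> /eqP fij /eqP gij e2 off.
have flip (h : {ffun 'I_n -> 'I_k * bool}) : (h i).1 = (h j).1 ->
   h j = ((h i).1, (h i).2 (+) ~~ (h i == h j)).
  case: (h i) (h j) => [v b] [w c] /= <-; rewrite xpair_eqE eqxx /=.
  by case: b c => -[].
have offi y : y != j -> ((f i).1 == (f y).1) = ((g i).1 == (g y).1) /\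
     (f i == f y) = (g i == g y).
  by move=> yj; have := off i y ij yj; rewrite !ffunE /= => -[].
have offj y : y != j -> ((f j).1 == (f y).1) = ((g j).1 == (g y).1) /\
     (f j == f y) = (g j == g y).
  move=> /offi[]; rewrite (flip f) // (flip g) // -e2; move: (f i == f j) => s.
  case: (f i) (f y) (g i) (g y) => [v b] [w c] [v' b'] [w' c'] /=.
  rewrite !xpair_eqE => ->; case: (v' == w') => //=.
  by case: b c b' c' s => -[] [] [] [].
apply/ffunP => -[x y]; rewrite !ffunE /=.
have [->|xj] := eqVneq x j; have [->|yj] := eqVneq y j.
- by rewrite !eqxx.
- by have [-> ->] := offj y yj.
- have [h1 h2] := offj x xj; rewrite eq_sym h1 eq_sym.
  by rewrite [f x == _]eq_sym h2 [g x == _]eq_sym.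
- by have := off x y xj yj; rewrite !ffunE.
Qed.

(* Moving [j] from its block to any other block loses at most one bit. *)
Lemma card_linked n k Q (i j : 'I_n) : i != j ->
  Q * #|[set l in patterns n k | (l (i, j)).1 && has_blocks Q l]| <=
  2 * #|patterns n k|.
Proof.
move=> ij; set B := [set _ in _ | _].
pose move_to (l : table n) (c : 'I_Q) x := if x == j then blocks_off Q j i l c else x.
(* Position [j] takes the literal of the representative of block [c]; the extra bit keeps its old
   sign relative to [i]. *)
pose h (p : table n * 'I_Q) : table n * bool :=
  ([ffun q => p.1 (move_to p.1 p.2 q.1, move_to p.1 p.2 q.2)], (p.1 (i, j)).2).
have move_off l c x : x != j -> move_to l c x = x by rewrite /move_to => /negPf ->.
have move_at l c : move_to l c j = blocks_off Q j i l c by rewrite /move_to eqxx.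
(* Entries away from [j] are unchanged, so [table_off] recovers [l]; then [c] is the block that [j]
   has joined. *)
have hinj : {in finset.setX B finset.setT &, injective h}.
  move=> [l c] [m d] /finset.setXP[+ _] /finset.setXP[+ _]; rewrite !inE.
  move=> /and3P[lin lij lb] /and3P[min mij mb] [/= e e2].
  have {}e x y : l (move_to l c x, move_to l c y) = m (move_to m d x, move_to m d y).
    by move/ffunP/(_ (x, y)): e; rewrite !ffunE.
  have lm : l = m.
    apply: (table_off ij lin min lij mij e2) => x y xj yj.
    by have := e x y; rewrite !move_off.
  subst m; congr (_, _).
  have [/separatedP sep offj] := blocks_offP ij lin lij lb.
  apply/esym/sep; have := e j (blocks_off Q j i l c).
  rewrite !move_at !(move_off _ _ _ (offj c)) => <-.
  by case/imsetP: lin => f _ ->; rewrite ffunE /= eqxx.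
have -> : Q * #|B| = #|finset.setX B [set: 'I_Q]%SET| by rewrite cardsX cardsT card_ord mulnC.
have -> : 2 * #|patterns n k| = #|finset.setX (patterns n k) [set: bool]%SET|.
  by rewrite cardsX cardsT card_bool mulnC.
rewrite -(card_in_imset hinj) subset_leq_card //.
apply/fintype.subsetP => _ /imsetP[[l c] /finset.setXP[lB _] ->]; rewrite !inE andbT /=.
move: lB; rewrite inE => /andP[/imsetP[f _ el] _].
suff -> : [ffun q => l (move_to l c q.1, move_to l c q.2)] =
          pattern (fun x => f (move_to l c x)) by exact: pattern_in.
by apply/ffunP => q; rewrite el !ffunE.
Qed.

Lemma patterns_linked e : exists N, forall n k, N <= n -> N <= k ->
  forall i j : 'I_n, i != j ->
  e * #|[set l in patterns n k | (l (i, j)).1]| <= #|patterns n k|.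
Proof.
(* With this [Q], patterns having [Q] blocks and those without each account for at most half of the
   bound. The factor [(2 * Q) ^ Q] below pays for the [Q] reference positions of
   [card_patterns_ge]. *)
pose P := 4 * e; pose Q := P.+1.
have [n0 hn0] := geometric_beats_linear (2 * e * (2 * Q) ^ Q) P.
exists (n0 + Q) => n k hn hk i j ij.
set L := #|patterns n k|.
have few : 2 * e * #|[set l in patterns n k | ~~ has_blocks Q l]| <= L.
  have eQ : n = Q + (n - Q) by lia.
  have Qk : Q <= k by lia.
  have := card_patterns_ge (n - Q) Qk; rewrite -eQ -/L => lower.
  have := hn0 n; rewrite -/Q => /(_ ltac:(lia)) geo.
  have pos : 0 < (2 * Q) ^ Q by rewrite expn_gt0.
  apply: leq_trans (leq_mul (leqnn _) (card_few_blocks n k P)) _.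
  apply: leq_trans lower; rewrite -(leq_pmul2l pos) -expnD -eQ.
  move: geo; move: ((2 * Q) ^ Q) => X; rewrite !expnMn => geo.
  by have := leq_mul (leqnn (2 ^ n)) geo; lia.
have many := card_linked k Q ij; rewrite -/L in many.
set B := [set l in _ | _] in few; set C := [set l in _ | _ && _] in many.
have le : #|[set l in patterns n k | (l (i, j)).1]| <= #|C| + #|B|.
  apply: leq_trans (leq_card_setU C B); apply/subset_leq_card/fintype.subsetP => l.
  by rewrite !inE => /andP[-> ->] /=; case: has_blocks.
have : 4 * e * #|C| <= 2 * L.
  by apply: leq_trans many; rewrite leq_mul2r /Q /P leqnSn orbT.
move: few le; move: #|B| #|C| #|[set _ in _ | _]| => b c x; nia.
Qed.

(** * Equivalence classes as pairs of a skeleton and a pattern *)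

Local Open Scope classical_set_scope.

Lemma card_fset_set_image (T U : choiceType) (F : T -> U) (s : seq T) :
  uniq s -> {in s &, injective F} -> #|` fset_set (F @` [set` s])| = size s.
Proof.
move=> us injF.
have -> : [set` s] = [set` [fset x in s]%fset].
  by apply/seteqP; split=> x /=; rewrite inE.
rewrite fset_set_image ?set_fsetK; last exact: finite_fset.
rewrite card_in_imfset /=; first by rewrite card_fseq undup_id.
by move=> x y; rewrite !inE; exact: injF.
Qed.

Definition literal_at (t : andor_tree) (i : nat) : nat * bool :=
  (lit_var (leaf_at t i), lit_neg (leaf_at t i)).

Lemma literal_at_inj t u i j :
  (literal_at t i == literal_at u j) <-> leaf_at t i = leaf_at u j.
Proof.
rewrite /literal_at; case: (leaf_at t i) (leaf_at u j) => [v b] [w c] /=.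
by split=> [/eqP[-> ->]|[-> ->]].
Qed.

Definition tree_pattern n (t : andor_tree) : table n :=
  pattern (fun i : 'I_n => literal_at t i).

Lemma tree_patternE n t i j : tree_pattern n t (i, j) =
  ((literal_at t i).1 == (literal_at t j).1, literal_at t i == literal_at t j).
Proof. by rewrite ffunE. Qed.

Lemma equiv_treeE n t u : tree_size t = n ->
  equiv_tree t u <-> skeleton t = skeleton u /\ tree_pattern n t = tree_pattern n u.
Proof.
move=> tn; rewrite /equiv_tree tn; split=> [[-> hv hl]|[-> e]].
  split=> //; apply/ffunP => -[i j]; rewrite !tree_patternE; congr (_, _).
    by apply/eqP/eqP => /(hv i j (ltn_ord i) (ltn_ord j)).
  by apply/idP/idP => /literal_at_inj /(hl i j (ltn_ord i) (ltn_ord j)) /literal_at_inj.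
split=> // i j hi hj; move/ffunP/(_ (Ordinal hi, Ordinal hj)): e;
  rewrite !tree_patternE /= => -[ev el].
- by split=> /eqP; [rewrite ev|rewrite -ev] => /eqP.
- by split=> /literal_at_inj; [rewrite el|rewrite -el] => /literal_at_inj.
Qed.

(** Leaf ranks run from left to right, hence the shift by [tree_size a] on the right. *)
Fixpoint relabel (s : tree unit) (f : nat -> literal) : andor_tree :=
  match s with
  | Leaf _ => Leaf (f 0)
  | Node c a b => Node c (relabel a f) (relabel b (fun i => f (tree_size a + i)))
  end.

Lemma relabel_skeleton s f : skeleton (relabel s f) = s.
Proof. by elim: s f => [[]|c a IHa b IHb] f //=; rewrite IHa IHb. Qed.

Lemma relabel_leaves s f : leaves (relabel s f) = mkseq f (tree_size s).
Proof.
elim: s f => [[]|c a IHa b IHb] f //=.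
rewrite IHa IHb tree_size_Node /mkseq iotaD map_cat; congr (_ ++ _).
by rewrite add0n -[in RHS](addn0 (tree_size a)) iotaDl -map_comp.
Qed.

Definition codes n k : seq (tree unit * table n) :=
  [seq (s, l) | s <- skeletons n, l <- enum (patterns n k)].

Lemma codes_uniq n k : uniq (codes n k).
Proof.
apply: allpairs_uniq; [exact: skeletons_uniq|exact: enum_uniq|].
by move=> [a b] [c d] _ _.
Qed.

Lemma size_codes n k : size (codes n k) = size (skeletons n) * #|patterns n k|.
Proof. by rewrite size_allpairs cardE. Qed.

(** The choices of skeleton and pattern are independent: relabelling realises any pair, and
    [pattern_few] gives the converse. *)
Lemma codesP n k p : reflect
  (exists t, [/\ tree_size t = n, nb_vars t <= k & p = (skeleton t, tree_pattern n t)])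
  (p \in codes n k).
Proof.
apply: (iffP allpairsP) => [[[s l] /= [+ + ->]]|[t [tn tk ->]]].
  rewrite mem_skeletons mem_enum => /eqP sn /imsetP[f _ ->].
  (* The default literal is only for ranks at least [n], which no leaf has. *)
  pose g i := if insub i is Some o then Literal (f o).1 (f o).2 else Literal 0 false.
  have gE (i : 'I_n) : g i = Literal (f i).1 (f i).2 by rewrite /g valK.
  exists (relabel s g).
  have size_rel : tree_size (relabel s g) = n.
    by rewrite /tree_size relabel_leaves size_mkseq.
  split=> //.
    rewrite /nb_vars relabel_leaves sn -(size_iota 0 k).
    apply: uniq_leq_size; first exact: undup_uniq.
    move=> v; rewrite mem_undup /mkseq -map_comp => /mapP[i hi ->].
    rewrite mem_iota in hi; rewrite mem_iota /= (gE (Ordinal hi)) /=.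
    exact: ltn_ord.
  rewrite relabel_skeleton; congr (_, _); apply/ffunP => -[i j].
  have at_g (o : 'I_n) : literal_at (relabel s g) o = (val (f o).1, (f o).2).
    by rewrite /literal_at /leaf_at relabel_leaves sn nth_mkseq// gE.
  rewrite tree_patternE !at_g ffunE /=; case: (f i) (f j) => [v b] [w c] /=.
  by rewrite !xpair_eqE -!val_eqE.
exists (skeleton t, tree_pattern n t); split=> //=.
  by rewrite mem_skeletons tree_size_skeleton tn.
rewrite mem_enum; apply: pattern_few; apply: leq_trans tk; rewrite eq_leq //.
congr (size (undup _)).
rewrite -[leaves t](mkseq_nth (Literal 0 false)) -/(tree_size t) tn /mkseq.
by rewrite -val_enum_ord -!map_comp.
Qed.

Definition class_of n (p : tree unit * table n) : set andor_tree :=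
  [set u | skeleton u = p.1 /\ tree_pattern n u = p.2].

Lemma equiv_classE n t : tree_size t = n ->
  Defs.equiv_class t = class_of (skeleton t, tree_pattern n t).
Proof.
move=> tn; apply/seteqP; split=> u /=.
  by move/(equiv_treeE _ tn) => [-> ->].
by move=> [/= e1 e2]; apply/(equiv_treeE _ tn).
Qed.

Lemma classesE n k : classes n k = @class_of n @` [set` codes n k].
Proof.
apply/seteqP; split=> [_ [t [tn tk] <-]|_ [p /codesP[t [tn tk ->]] <-]].
  rewrite (equiv_classE tn); exists (skeleton t, tree_pattern n t) => //.
  by apply/codesP; exists t.
by exists t; rewrite ?(equiv_classE tn).
Qed.

(** The class of a code contains a tree realising it, and any member of a class determines its
    code. *)
Lemma class_of_inj n k : {in codes n k &, injective (@class_of n)}.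
Proof.
move=> p q /codesP[t [_ _ ->]] _ /seteqP[/(_ t) + _].
by case=> // /= -> ->; case: q.
Qed.

Lemma card_classesE n k : card_classes n k = size (skeletons n) * #|patterns n k|.
Proof.
rewrite /card_classes classesE (card_fset_set_image (codes_uniq n k)) ?size_codes//.
exact: class_of_inj.
Qed.

Lemma card_classes_gt0 n k : (0 < n) -> (0 < k) -> 0 < card_classes n k.
Proof.
case: n => // n _ k_gt0; rewrite card_classesE muln_gt0; apply/andP; split.
  elim: n => [|n IH]; first by rewrite skeletons1.
  rewrite -/(nb_skeletons _) nb_skeletonsS muln_gt0 big_ord_recr /= addn_gt0.
  by rewrite subnn muln_gt0 IH /nb_skeletons skeletons1 orbT.
by have := card_patterns_ge n k_gt0; apply: leq_trans; rewrite expn_gt0.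
Qed.

(** * Linked selected leaves and the union bound *)

Definition linked n (s : tree unit) (l : table n) :=
  [exists i : 'I_n, exists j : 'I_n,
    [&& val i \in selected s, val j \in selected s, i != j & (l (i, j)).1]].

Lemma unlinked_satisfiable n t : tree_size t = n ->
  ~~ linked (skeleton t) (tree_pattern n t) -> satisfiable (computes t).
Proof.
move=> tn /existsPn nl; apply: selected_satisfiable => i j hi hj ij.
have hin : i < n by rewrite -tn (selected_lt hi).
have hjn : j < n by rewrite -tn (selected_lt hj).
have /existsPn/(_ (Ordinal hjn)) := nl (Ordinal hin).
by rewrite !selected_skeleton /= hi hj -val_eqE /= ij /= tree_patternE.
Qed.

Definition linked_codes n k := [seq p <- codes n k | linked p.1 p.2].

(** Unlinked codes give pairwise distinct classes, all of whose trees are satisfiable. *)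
Lemma card_sat_classes_ge n k :
  card_classes n k <= card_sat_classes n k + size (linked_codes n k).
Proof.
have inj := @class_of_inj n k.
rewrite card_classesE -size_codes -(count_predC (fun p => linked p.1 p.2)).
rewrite -!size_filter addnC leq_add2r.
set G := [seq _ <- _ | _].
have subG : {subset G <= codes n k} by move=> p; rewrite mem_filter => /andP[].
rewrite -(@card_fset_set_image _ _ (@class_of n) G); last 2 first.
- by rewrite filter_uniq ?codes_uniq.
- by move=> p q /subG hp /subG hq; exact: inj.
apply/fsubset_leq_card; rewrite -fset_set_sub; last 2 first.
- exact/finite_image/finite_seq.
- exact: finite_sat_classes.
move=> _ [p pG <-]; split; first by rewrite classesE; exists p => //; exact: subG.
move=> t [/= e1 e2].
have /codesP[u [un _ pu]] := subG _ pG.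
have tn : tree_size t = n.
  by rewrite -tree_size_skeleton e1 pu /= tree_size_skeleton.
apply: (unlinked_satisfiable tn); rewrite e1 e2.
by move: pG; rewrite /= mem_filter => /andP[].
Qed.

Lemma card_sat_classes_le n k : card_sat_classes n k <= card_classes n k.
Proof.
apply/fsubset_leq_card; rewrite -fset_set_sub.
- by move=> C [].
- exact: finite_sat_classes.
- exact: finite_classes.
Qed.

Lemma size_linked_codes n k :
  size (linked_codes n k) =
  \sum_(s <- skeletons n) #|[set l in patterns n k | linked s l]|.
Proof.
rewrite /linked_codes size_filter /codes count_flatten sumnE !big_map.
apply: eq_bigr => s _; rewrite count_map -size_filter.
rewrite cardE; apply/perm_size/uniq_perm; [exact/filter_uniq/enum_uniq|exact: enum_uniq|].
by move=> l; rewrite mem_filter !mem_enum !inE andbC.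
Qed.

Lemma card_linked_le n k e : 
  (forall i j : 'I_n, i != j ->
     e * #|[set l in patterns n k | (l (i, j)).1]| <= #|patterns n k|) ->
  forall s, e * #|[set l in patterns n k | linked s l]| <=
            size (selected s) ^ 2 * #|patterns n k|.
Proof.
move=> he s; pose S := [set i : 'I_n | val i \in selected s]%SET.
have cS : #|S| <= size (selected s).
  rewrite cardE -(size_map (@nat_of_ord n)); apply: uniq_leq_size.
    by rewrite map_inj_uniq; [exact: enum_uniq|exact: val_inj].
  by move=> _ /mapP[i + ->]; rewrite mem_enum inE.
(* The guard [p.1 != p.2] empties the diagonal terms, so the union can run over the full square of
   [S]. *)
pose B (p : 'I_n * 'I_n) := [set l in patterns n k | (p.1 != p.2) && (l p).1]%SET.
have sub : [set l in patterns n k | linked s l]%SET \subset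
           (\bigcup_(p in finset.setX S S) B p)%SET.
  apply/fintype.subsetP => l; rewrite inE => /andP[lin].
  case/existsP=> i /existsP[j /and4P[hi hj ij lij]].
  apply/finset.bigcupP; exists (i, j); first by rewrite !inE hi hj.
  by rewrite !inE lin ij.
apply: leq_trans (leq_mul (leqnn e) (subset_leq_card sub)) _.
have cup : #|(\bigcup_(p in finset.setX S S) B p)%SET| <=
           \sum_(p in finset.setX S S) #|B p|.
  elim/big_rec2: _ => [|p m C _ IH]; first by rewrite cards0.
  by apply: leq_trans (leq_card_setU _ _) _; rewrite leq_add2l.
apply: leq_trans (leq_mul (leqnn e) cup) _; rewrite big_distrr /=.
apply: leq_trans (_ : _ <= \sum_(p in finset.setX S S) #|patterns n k|) _.
  apply: leq_sum => -[i j] _.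
  have [<-|ij] := eqVneq i j.
    by rewrite [#|B _|]eq_card0 ?muln0// => l; rewrite !inE eqxx andbF.
  apply: leq_trans (he i j ij); rewrite leq_mul2l; apply/orP; right.
  by apply/subset_leq_card/fintype.subsetP => l; rewrite !inE => /and3P[-> _ ->].
by rewrite sum_nat_const cardsX leq_mul2r -mulnn leq_mul ?orbT.
Qed.

Lemma unsat_negligible N : exists n0, forall n k, n0 <= n -> n0 <= k ->
  N * size (linked_codes n k) <= card_classes n k.
Proof.
pose K := 12 * N.
have [n0 hn0] := patterns_linked (2 * N * K ^ 2).
exists n0.+1 => n k hn hk.
have bound := card_linked_le (hn0 n k (ltnW hn) (ltnW hk)).
rewrite card_classesE size_linked_codes.
have n_gt0 : 0 < n by lia.
have := mean_selected n_gt0.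
set a := size (skeletons n); set L := #|patterns n k| in bound *; move=> mean.
(* Markov's inequality in pointwise form. Up to [K] selected leaves, the union bound gives [6 * L];
   beyond [K = 12 * N], the trivial bound by [L] gives the second term. Summed over skeletons, each
   term is at most [6 * a * L]. *)
have each s : 12 * N * #|[set l in patterns n k | linked s l]%SET| <=
    6 * L + size (selected s) * L.
  have := bound s; set b := #|_|; set m := size _.
  have bL : b <= L by apply/subset_leq_card/fintype.subsetP => l; rewrite inE => /andP[].
  have [mK|Km] := leqP m K => h.
    have [K0|K0] := posnP K; first by rewrite -/K K0.
    have : K ^ 2 * (2 * N * b) <= K ^ 2 * L.
      apply: leq_trans (_ : _ <= m ^ 2 * L) _; first by apply: leq_trans h; lia.
      by rewrite leq_mul2r leq_exp2r// mK orbT.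
    rewrite leq_pmul2l ?expn_gt0 ?K0//; lia.
  rewrite -/K; apply: leq_trans (leq_addl _ _); apply: leq_mul => //; exact: ltnW.
rewrite -(leq_pmul2l (isT : 0 < 12)) mulnA big_distrr /=.
apply: leq_trans (leq_sum _ (fun s _ => each s)) _.
rewrite big_split /= sum_seq_const -big_distrl /= -/a.
apply: leq_trans (_ : _ <= a * (6 * L) + 6 * a * L) _; last by lia.
by rewrite leq_add2l leq_mul2r mean orbT.
Qed.

(** * Convergence of the proportion *)

Local Open Scope ring_scope.

Theorem theorem1 (R : realType) (k : nat -> nat)
  (k_pos : forall n : nat, (1 <= n)%N -> (0 < k n)%N)
  (k_incr : forall m n : nat, (1 <= m)%N -> (m <= n)%N -> (k m <= k n)%N)
  (k_infty : k n @[n --> \oo] --> \oo) :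
  (card_sat_classes n (k n))%:R / (card_classes n (k n))%:R @[n --> \oo]
    --> (1 : R).
Proof.
apply/cvgrPdist_le => e e_gt0.
(* As [N] exceeds [1/e], a fraction at most [1/N] of remaining classes puts the proportion within
   [e] of 1. *)
pose N := (Num.truncn e^-1).+1.
have [n0 hn0] := unsat_negligible N.
move/cvgnyPge: k_infty => /(_ n0.+1) k_large.
near=> n.
have hn : (n0 < n)%N by near: n; exact: nbhs_infty_gt.
have hk : (n0 < k n)%N by near: n.
have le := hn0 n (k n) (ltnW hn) (ltnW hk).
have ge := card_sat_classes_ge n (k n).
have sc := card_sat_classes_le n (k n).
have c_gt0 : (0 < card_classes n (k n))%N.
  by apply: card_classes_gt0; lia.
have cR : 0 < (card_classes n (k n))%:R :> R by rewrite ltr0n.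
rewrite -[X in X - _](divff (lt0r_neq0 cR)) -mulrBl -natrB //.
rewrite ger0_norm; last by rewrite divr_ge0 ?ler0n.
rewrite ler_pdivrMr //.
have eN : e^-1 <= N%:R by apply/ltW/truncnS_gt.
rewrite -(ler_pM2l (_ : 0 < e^-1)) ?invr_gt0 // mulrA mulVf ?lt0r_neq0 // mul1r.
apply: le_trans (_ : N%:R * (card_classes n (k n) - card_sat_classes n (k n))%:R <= _).
  by rewrite ler_wpM2r ?ler0n.
rewrite -natrM ler_nat; apply: leq_trans le; rewrite leq_mul2l.
by apply/orP; right; lia.
Unshelve. all: by end_near.
Qed.
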